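(* Let $F_2=F_2(x,z)$ be a smooth function with $\frac{\partial F_2}{\partial x}\ne0$ satisfying $$\frac{\partial F_2}{\partial z}+\frac{\partial^3 F_2}{\partial x^3}-\frac32\,\frac{\left(\frac{\partial^2 F_2}{\partial x^2}\right)^2}{\frac{\partial F_2}{\partial x}}=0,$$ and put $$l(x,z)=\left(\frac{\partial^3F_2}{\partial x^3}-\frac12\,\frac{\left(\frac{\partial^2F_2}{\partial x^2}\right)^2}{\frac{\partial F_2}{\partial x}}\right)\left(\frac{\partial F_2}{\partial x}\right)^{-1},\qquad m(x,z)=-\frac12 .$$ Let $L=L(u,w)$ and $M=M(u,w)$ be smooth functions satisfying $$\frac{\partial L}{\partial w}-3L\,\frac{\partial L}{\partial u}+\frac{\partial^3L}{\partial u^3}=0,\qquad \frac{\partial M}{\partial w}=L\,\frac{\partial M}{\partial u}+\frac{\partial L}{\partial u}+2\,\frac{\partial L}{\partial u}\,M .$$ Then the six-dimensional metric in local coordinates $(x,y,z,u,v,w)$ $$ds^2=y^2dx^2+2\left(y^2l+m\right)dx\,dz+2\,dy\,dz+\left(y^2l^2-2y\,\frac{\partial l}{\partial x}+2l+2lm\right)dz^2$$ $$\qquad+v^2du^2+2\left(v^2L+M\right)du\,dw+2\,dv\,dw+\left(v^2L^2-2v\,\frac{\partial L}{\partial u}+2L+2LM\right)dw^2,$$ where $l=l(x,z)$, $m=m(x,z)$, $L=L(u,w)$, $M=M(u,w)$, considered on the open set where $y\neq0$ and $v\neq0$, is flat.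
   Context: A (pseudo-Riemannian) metric is called flat if its Riemann curvature tensor vanishes identically, $R_{ijkl}=0$. In the line element, $dx\,dz$ etc. denote symmetric products, so that the coefficient of $dx^i\,dx^j$ with $i\neq j$ equals $2g_{ij}$. All functions are smooth functions of real variables on suitable open domains. *)

(* Defs.v *)
From HB Require Import structures.
From mathcomp Require Export all_boot all_order all_algebra.
From mathcomp Require Export boolp classical_sets reals topology normedtype derive.

Set Implicit Arguments.
Unset Strict Implicit.
Unset Printing Implicit Defensive.

Export Order.TTheory GRing.Theory Num.Theory.
Export numFieldNormedType.Exports.

Local Open Scope classical_set_scope.
Local Open Scope ring_scope.

Section Calculus.
Context {R : realType} {n : nat}.

Definition partial (i : 'I_n) (f : 'rV[R]_n -> R) : 'rV[R]_n -> R :=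
  fun p => 'D_(delta_mx 0 i) f p.

(* C^infinity on an open set D: every iterated partial derivative of f, in
   every order (the empty list gives f itself), exists and is continuous at
   each point of D.  Existence is required separately because ['D_v f] is a
   total operator with an arbitrary value where f is not derivable. *)
Definition smooth_on (D : set 'rV[R]_n) (f : 'rV[R]_n -> R) : Prop :=
  forall (s : seq 'I_n) (p : 'rV[R]_n), D p ->
    {for p, continuous (foldr partial f s)} /\
    forall i, derivable (foldr partial f s) p (delta_mx 0 i).

End Calculus.

Section Curvature.
Context {R : realType} {n : nat}.
Implicit Types (D : set 'rV[R]_n) (g : 'rV[R]_n -> 'M[R]_n).

Definition pseudo_riemannian_on D g : Prop :=
  [/\ open D,
      forall i j, smooth_on D (fun p => g p i j),
      forall p, D p -> (g p)^T = g p
    & forall p, D p -> g p \in unitmx].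

(* [christoffel g i j k] is Gamma^i_{jk}. *)
Definition christoffel g (i j k : 'I_n) (p : 'rV[R]_n) : R :=
  2^-1 * \sum_(a < n) invmx (g p) i a *
    (partial j (fun q => g q a k) p + partial k (fun q => g q a j) p
     - partial a (fun q => g q j k) p).

(* [riemann_up g i j k l] is R^i_{jkl}. *)
Definition riemann_up g (i j k l : 'I_n) (p : 'rV[R]_n) : R :=
  partial k (christoffel g i l j) p - partial l (christoffel g i k j) p
  + \sum_(a < n) (christoffel g i k a p * christoffel g a l j p
                  - christoffel g i l a p * christoffel g a k j p).

Definition riemann g (i j k l : 'I_n) (p : 'rV[R]_n) : R :=
  \sum_(a < n) g p i a * riemann_up g a j k l p.

Definition flat_on D g : Prop :=
  forall p, D p -> forall i j k l, riemann g i j k l p = 0.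

(* The symmetric product dx^i dx^j; a term c dx^i dx^j of a line element with
   i != j thus contributes c / 2 to both g_{ij} and g_{ji}. *)
Definition dxdx (i j : 'I_n) : 'M[R]_n :=
  2^-1 *: (delta_mx i j + delta_mx j i).

End Curvature.

Definition ix : 'I_6 := @Ordinal 6 0 isT.
Definition iy : 'I_6 := @Ordinal 6 1 isT.
Definition iz : 'I_6 := @Ordinal 6 2 isT.
Definition iu : 'I_6 := @Ordinal 6 3 isT.
Definition iv : 'I_6 := @Ordinal 6 4 isT.
Definition iw : 'I_6 := @Ordinal 6 5 isT.

Section Metric.
Context {R : realType}.
Implicit Types (f h l m L M : 'rV[R]_2 -> R) (p : 'rV[R]_6).

Definition coord2 (a c : 'I_6) p : 'rV[R]_2 :=
  \row_(k < 2) (if k == 0 then p 0 a else p 0 c).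

(* The three-dimensional part of the line element in the coordinates of
   indices (a, b, c), e.g. (x, y, z), with f, h functions of the coordinates
   a and c only; [partial 0 f] is the derivative with respect to coordinate a. *)
Definition line_element3 (a b c : 'I_6) f h p : 'M[R]_6 :=
  let q := coord2 a c p in
  let t := p 0 b in
    t ^+ 2 *: dxdx a a
    + (2 * (t ^+ 2 * f q + h q)) *: dxdx a c
    + 2 *: dxdx b c
    + (t ^+ 2 * f q ^+ 2 - 2 * t * partial 0 f q + 2 * f q + 2 * f q * h q)
        *: dxdx c c.

Definition metric6 l m L M p : 'M[R]_6 :=
  line_element3 ix iy iz l m p + line_element3 iu iv iw L M p.

Definition domain6 (U V : set 'rV[R]_2) : set 'rV[R]_6 :=
  [set p | [/\ U (coord2 ix iz p), V (coord2 iu iw p),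
               p 0 iy != 0 & p 0 iv != 0]].

End Metric.

(* Main.v *)
Require Import Defs.
From mathcomp Require Import ring lra.

(* The metric is block diagonal with two blocks of the same shape, and each block
   is flat as soon as its functions f and h satisfy f_z = 3 f f_x - f_xxx (KdV) and
   h_z = f h_x + f_x + 2 f_x h. For the first block, l is a Miura-type differential
   function of the solution F2 of the Schwarzian KdV equation, so it solves KdV, and
   the second equation holds for the constant m = -1/2.

   Flatness is checked in a differential polynomial ring: since mixed partials
   commute, the evolution equations express every derivative in z through
   derivatives in x only, so the curvature components become polynomials in y, 1/y
   and the x-jets of f and h, and these polynomials vanish identically. *)

Set Implicit Arguments.
Unset Strict Implicit.
Unset Printing Implicit Defensive.

Local Open Scope classical_set_scope.
Local Open Scope ring_scope.

Lemma open_near (T : topologicalType) (D : set T) (p : T) (P : T -> Prop) :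
  open D -> D p -> (forall q, D q -> P q) -> \forall q \near p, P q.
Proof.
move=> oD Dp HP; have : nbhs p D by apply: open_nbhs_nbhs; split.
exact: filterS.
Qed.

(** * Symmetry of mixed derivatives *)

Section MixedDerivatives.
Context {R : realType} {V : normedModType R}.
Implicit Types (f : V -> R) (p u v : V).

Lemma is_derive_line f u p (t : R) : derivable f (t *: u + p) u ->
  is_derive t 1 (fun s : R => f (s *: u + p)) ('D_u f (t *: u + p)).
Proof.
move=> df.
have E : (fun h : R => h^-1 *: (((fun s : R => f (s *: u + p)) \o shift t) (h *: 1)
             - f (t *: u + p)))
  = (fun h : R => h^-1 *: ((f \o shift (t *: u + p)) (h *: u) - f (t *: u + p))).
  by apply/funext => h; rewrite /= [h *: 1]mulr1 scalerDl addrA.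
split; first by rewrite /derivable E.
by rewrite /derive E.
Qed.

Lemma directional_MVT f u p (s : R) : 0 < s ->
  (forall t, 0 <= t <= s -> derivable f (t *: u + p) u) ->
  exists2 t, 0 <= t <= s & f (s *: u + p) - f p = s * 'D_u f (t *: u + p).
Proof.
move=> s0 df.
have df' t : 0 <= t <= s ->
    is_derive t 1 (fun s => f (s *: u + p)) ('D_u f (t *: u + p)).
  by move=> /df; exact: is_derive_line.
have [||t tI E] := @MVT R (fun s => f (s *: u + p))
    (fun t => 'D_u f (t *: u + p)) 0 s s0.
- by move=> t; rewrite in_itv /= => /andP[t0 ts]; apply: df'; rewrite !ltW.
- apply: derivable_within_continuous => t; rewrite in_itv /= => /df' dt.
  exact: ex_derive.
- exists t; first by move: tI; rewrite in_itv /= => /andP[t0 ts]; rewrite !ltW.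
  by move: E; rewrite scale0r add0r subr0 mulrC.
Qed.

(** Bracketed as the increment along [u] of the increment of [f] along [v], the form to which the
    mean value theorem applies. *)
Let second_diff f u v s p := f (s *: u + (s *: v + p)) - f (s *: u + p)
  - (f (s *: v + p) - f p).

(** The mean value theorem is used twice: along [u] for the increment [g], then along [v] for the
    difference of values of ['D_u f] that results. [HD] keeps the whole parallelogram inside [D]. *)
Let second_diff_MVT (D : set V) f u v p (s : R) : 0 < s ->
  (forall a b, 0 <= a <= s -> 0 <= b <= s -> D (b *: v + (a *: u + p))) ->
  (forall q, D q -> derivable f q u) ->
  (forall q, D q -> derivable ('D_u f) q v) ->
  exists a b, [/\ 0 <= a <= s, 0 <= b <= s &
    second_diff f u v s p = s * (s * 'D_v ('D_u f) (b *: v + (a *: u + p)))].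
Proof.
move=> s0 HD du dvu.
pose g (q : V) := f (s *: v + q) - f q.
have sI : 0 <= s <= s by rewrite lexx ltW.
have zI : 0 <= (0 : R) <= s by rewrite lexx ltW.
have dg a : 0 <= a <= s -> is_derive (a *: u + p) u g
    ('D_u f (s *: v + (a *: u + p)) - 'D_u f (a *: u + p)).
  move=> aI; apply: is_deriveB.
    have /derivableP[c1 c2] := du _ (HD _ _ aI sI).
    have E : (fun h : R => h^-1 *:
        (((fun q => f (s *: v + q)) \o shift (a *: u + p)) (h *: u)
         - f (s *: v + (a *: u + p))))
      = (fun h : R => h^-1 *: ((f \o shift (s *: v + (a *: u + p))) (h *: u)
         - f (s *: v + (a *: u + p)))).
      by apply/funext => h; rewrite /= addrCA.
    by split; [rewrite /derivable E|rewrite /derive E].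
  by apply/derivableP; have := du _ (HD _ _ aI zI); rewrite scale0r add0r.
have [a aI Ea] := @directional_MVT g u p s s0
  (fun a aI => @ex_derive _ _ _ _ _ _ _ (dg a aI)).
have [b bI Eb] := @directional_MVT ('D_u f) v (a *: u + p) s s0
  (fun b bI => dvu _ (HD _ _ aI bI)).
exists a, b; split => //.
rewrite -Eb -(@derive_val _ _ _ _ _ _ _ (dg a aI)) -Ea /g /second_diff.
rewrite (addrCA (s *: v)); ring.
Qed.

Let second_diffC f u v s p : second_diff f u v s p = second_diff f v u s p.
Proof. by rewrite /second_diff (addrCA (s *: u)); ring. Qed.

(* Schwarz's theorem: the mean value theorem, applied in either order, writes the
   second difference of f as s^2 times either mixed derivative at a nearby point. *)
Lemma derive_comm (D : set V) f u v p : open D -> D p ->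
  (forall q, D q -> derivable f q u) ->
  (forall q, D q -> derivable f q v) ->
  (forall q, D q -> derivable ('D_u f) q v) ->
  (forall q, D q -> derivable ('D_v f) q u) ->
  {for p, continuous ('D_v ('D_u f))} ->
  {for p, continuous ('D_u ('D_v f))} ->
  'D_v ('D_u f) p = 'D_u ('D_v f) p.
Proof.
move=> oD Dp du dv dvu duv cvu cuv.
apply/eqP; rewrite -subr_eq0 -normr_le0; apply/ler_addgt0Pl => e e0.
rewrite addr0.
have close (a b c : R) : `|a - c| < e / 2 -> `|b - c| < e / 2 -> `|a - b| <= e.
  move=> ac bc; rewrite -[X in `|X|](subrKA c) (splitr e).
  by apply: le_trans (ler_normD _ _) _; rewrite (distrC c) lerD// ltW.
have e20 : 0 < e / 2 by rewrite divr_gt0.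
have h1 := (@cvgrPdist_lt _ _ _ _ (nbhs_filter p) _ _).1 cvu _ e20.
have h2 := (@cvgrPdist_lt _ _ _ _ (nbhs_filter p) _ _).1 cuv _ e20.
have h3 := open_near oD Dp (fun q (h : D q) => h).
have hP := @filterI _ _ (nbhs_filter p) _ _ h3 (@filterI _ _ (nbhs_filter p) _ _ h1 h2).
have [d /= d0 Hd] := (@nbhs_normP _ _ _ _).1 hP.
(* Small enough that the parallelogram with sides [s *: u] and [s *: v] at [p] stays within [d] of
   [p]; the summand 1 covers [u = v = 0]. *)
pose s := d / (2 * (`|u| + `|v| + 1)).
have k0 : 0 < `|u| + `|v| + 1 by rewrite ltr_wpDl// addr_ge0.
have s0 : 0 < s by rewrite divr_gt0// mulr_gt0.
have Hs a b w w' : 0 <= a <= s -> 0 <= b <= s -> `|w| + `|w'| = `|u| + `|v| ->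
    `|p - (b *: w + (a *: w' + p))| < d.
  move=> /andP[a0 sa] /andP[b0 sb] ww.
  rewrite !opprD addrCA (addrCA p) subrr addr0 -opprD normrN.
  apply: (le_lt_trans (ler_normD _ _)).
  rewrite !normrZ !ger0_norm//.
  apply: (@le_lt_trans _ _ (s * (`|u| + `|v|))).
    by rewrite -ww mulrDr lerD// ler_wpM2r.
  have -> : d = s * (2 * (`|u| + `|v| + 1)) by rewrite /s divfK// mulf_neq0// gt_eqF.
  rewrite ltr_pM2l//; move: (normr_ge0 u) (normr_ge0 v); lra.
clearbody s.
have [a [b [aI bI E1]]] := @second_diff_MVT D f u v p s s0
  (fun a b aI bI => (Hd _ (Hs a b v u aI bI (addrC _ _))).1) du dvu.
have [a' [b' [a'I b'I E2]]] := @second_diff_MVT D f v u p s s0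
  (fun a b aI bI => (Hd _ (Hs a b u v aI bI erefl)).1) dv duv.
have [_ [hvu _]] := Hd _ (Hs a b v u aI bI (addrC _ _)).
have [_ [_ huv]] := Hd _ (Hs a' b' u v a'I b'I erefl).
(* The second difference is symmetric in [u] and [v], and both expressions for it carry the nonzero
   factor [s * s]. *)
have E : 'D_v ('D_u f) (b *: v + (a *: u + p)) =
         'D_u ('D_v f) (b' *: u + (a' *: v + p)).
  have s_neq0 : s != 0 by rewrite gt_eqF.
  apply: (mulfI s_neq0); apply: (mulfI s_neq0).
  by rewrite -[LHS]E1 -[RHS]E2; exact: second_diffC.
rewrite -E in huv.
exact: close hvu huv.
Qed.

End MixedDerivatives.

(** * Differential polynomials *)

(* [Cst m n] stands for the rational m / n. *)
Inductive expr (I : Type) : Type :=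
  | Cst of nat & nat
  | Var of I
  | Opp of expr I
  | Add of expr I & expr I
  | Mul of expr I & expr I.
Arguments Cst {I} _ _.

(* The operations below cancel 0 and 1, so that the expressions mixing the two
   blocks reduce to 0 by computation. *)
Definition is_zero I (e : expr I) := if e is Cst 0 _ then true else false.

Definition sopp I (e : expr I) := if is_zero e then e else Opp e.
Definition sadd I (e f : expr I) :=
  if is_zero e then f else if is_zero f then e else Add e f.
Definition smul I (e f : expr I) :=
  if is_zero e then e else if is_zero f then f else
  match e, f with Cst 1 1, _ => f | _, Cst 1 1 => e | _, _ => Mul e f end.

Declare Scope expr_scope.
Delimit Scope expr_scope with E.
Bind Scope expr_scope with expr.
Notation "x + y" := (sadd x y) : expr_scope.
Notation "- x" := (sopp x) : expr_scope.
Notation "x - y" := (sadd x (sopp y)) : expr_scope.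
Notation "x * y" := (smul x y) : expr_scope.
Notation "0" := (Cst 0 1) : expr_scope.
Notation "1" := (Cst 1 1) : expr_scope.
Notation "2" := (Cst 2 1) : expr_scope.
Notation "3" := (Cst 3 1) : expr_scope.

Fixpoint eval (R : realType) I (x : I -> R) (e : expr I) : R :=
  match e with
  | Cst m n => m%:R / n%:R
  | Var i => x i
  | Opp e => - eval x e
  | Add e f => eval x e + eval x f
  | Mul e f => eval x e * eval x f
  end.

Fixpoint deriv I (delta : I -> expr I) (e : expr I) : expr I :=
  match e with
  | Cst _ _ => 0
  | Var i => delta i
  | Opp e => - deriv delta e
  | Add e f => deriv delta e + deriv delta f
  | Mul e f => deriv delta e * f + e * deriv delta f
  end%E.

Fixpoint emap I J (phi : I -> J) (e : expr I) : expr J :=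
  match e with
  | Cst m n => Cst m n
  | Var i => Var (phi i)
  | Opp e => Opp (emap phi e)
  | Add e f => Add (emap phi e) (emap phi f)
  | Mul e f => Mul (emap phi e) (emap phi f)
  end.

(* [(false, k)] and [(true, k)] stand for the k-th derivatives of f and of h with
   respect to the first coordinate, f and h being l and m (or L and M). *)
Definition jet := (bool * nat)%type.
Definition jet_dx (j : jet) : expr jet := Var (j.1, j.2.+1).
Definition jet_f k : expr jet := Var (false, k).
Definition jet_h k : expr jet := Var (true, k).
(** The two evolution equations solved for the z-derivative: KdV for f, the linear equation for
    h. *)
Definition jet_rhs (b : bool) : expr jet :=
  (if b then jet_f 0 * jet_h 1 + jet_f 1 + 2 * jet_f 1 * jet_h 0
   else 3 * jet_f 0 * jet_f 1 - jet_f 3)%E.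
(** Since d/dz commutes with d/dx, the z-derivative of a k-th x-derivative is the k-th total
    x-derivative of the right-hand side. *)
Definition jet_dz (j : jet) : expr jet :=
  iter j.2 (deriv jet_dx) (jet_rhs j.1).

(* For the block [b] (false for x, y, z and true for u, v, w): [VT b] is the middle
   coordinate y or v, [VW b] its inverse, [VJ b j] a jet pulled back from the plane. *)
Inductive var := VT of bool | VW of bool | VJ of bool & jet.
Definition var_d (i : nat) (v : var) : expr var :=
  match v with
  | VT b => if (i == 3 * b + 1)%N then 1 else 0
  | VW b => if (i == 3 * b + 1)%N then - (Var (VW b) * Var (VW b)) else 0
  | VJ b j => if (i == 3 * b)%N then emap (VJ b) (jet_dx j)
              else if (i == 3 * b + 2)%N then emap (VJ b) (jet_dz j) else 0
  end%E.
Definition partial_expr i := deriv (var_d i).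

(** * Symbolic metric, Christoffel symbols and curvature *)

Definition same_block (s : seq nat) := constant (map (leq 3) s).

Section Tables.
Variable b : bool.
Let T := Var (VT b).
Let W := Var (VW b).
Let L k := Var (VJ b (false, k)).
Let M := Var (VJ b (true, 0%N)).
Definition block_metric (i j : nat) : expr var :=
  match i, j with
  | 0%N, 0%N => T * T
  | 0%N, 2%N | 2%N, 0%N => T * T * L 0 + M
  | 1%N, 2%N | 2%N, 1%N => 1
  | 2%N, 2%N => T * T * L 0 * L 0 - 2 * T * L 1 + 2 * L 0 + 2 * L 0 * M
  | _, _ => 0
  end%E.
(** The block has determinant [- T * T], so its inverse is polynomial once [W], standing for the
    inverse of [T], is adjoined. The table is checked in [mul_ginv]. *)
Definition block_inverse (i j : nat) : expr var :=
  match i, j with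
  | 0%N, 0%N => W * W
  | 0%N, 1%N | 1%N, 0%N => - (L 0 + M * W * W)
  | 1%N, 1%N => M * M * W * W + 2 * T * L 1 - 2 * L 0
  | 1%N, 2%N | 2%N, 1%N => 1
  | _, _ => 0
  end%E.
End Tables.

Definition block6 (t : bool -> nat -> nat -> expr var) (i j : nat) : expr var :=
  if same_block [:: i; j] then t (3 <= i)%N (i %% 3)%N (j %% 3)%N else 0%E.

Definition sum6 (F : nat -> expr var) : expr var :=
  (F 0%N + F 1%N + F 2%N + F 3%N + F 4%N + F 5%N)%E.

Definition metric_expr := block6 block_metric.
Definition inverse_expr := block6 block_inverse.
Definition christoffel_expr i j k :=
  (Cst 1 2 * sum6 (fun a => inverse_expr i a *
    (partial_expr j (metric_expr a k) + partial_expr k (metric_expr a j)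
     - partial_expr a (metric_expr j k))))%E.
(** The first index stays up, as in [riemann_up]: lowering it is linear and preserves vanishing. *)
Definition riemann_expr i j k l :=
  (partial_expr k (christoffel_expr i l j)
   - partial_expr l (christoffel_expr i k j)
   + sum6 (fun a => christoffel_expr i k a * christoffel_expr a l j
                    - christoffel_expr i l a * christoffel_expr a k j))%E.

Section Eval.
Context {R : realType} {I : Type}.
Implicit Types (x : I -> R) (e f : expr I).

Lemma is_zeroP x e : is_zero e -> eval x e = 0.
Proof. by case: e => // -[|//] n _ /=; rewrite mul0r. Qed.

Lemma eval_opp x e : eval x (sopp e) = - eval x e.
Proof. by rewrite /sopp; case: ifP => // /(is_zeroP x) ->; rewrite oppr0. Qed.

Lemma eval_add x e f : eval x (sadd e f) = eval x e + eval x f.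
Proof.
rewrite /sadd; case: ifP => [/(is_zeroP x)->|_]; first by rewrite add0r.
by case: ifP => // /(is_zeroP x) ->; rewrite addr0.
Qed.

Lemma eval_mul x e f : eval x (smul e f) = eval x e * eval x f.
Proof.
rewrite /smul; case: ifP => [/(is_zeroP x)->|_]; first by rewrite mul0r.
case: ifP => [/(is_zeroP x)->|_]; first by rewrite mulr0.
have e1 : eval x (Cst 1 1) = 1 by rewrite /= divr1.
have e1l : eval x f = eval x (Cst 1 1) * eval x f by rewrite e1 mul1r.
have e1r : eval x e = eval x e * eval x (Cst 1 1) by rewrite e1 mulr1.
case: e e1r => [[|[|m]] [|[|n]]|i|e|e e'|e e'] e1r //;
  by case: f e1l => [[|[|m']] [|[|n']]|i'|f|f f'|f f'] e1l.
Qed.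

Definition evalE := (eval_opp, eval_add, eval_mul).

Lemma eval_emap J (phi : I -> J) (y : J -> R) e :
  eval y (emap phi e) = eval (y \o phi) e.
Proof. by elim: e => //= [e ->|e -> f ->|e -> f ->]. Qed.

(** Soundness of formal differentiation: once [delta] gives the true derivatives of the generators,
    the sum and product rules extend this to all expressions. *)
Lemma is_derive_eval (V : normedModType R) (X : V -> I -> R) (p v : V)
    (delta : I -> expr I) :
  (forall i, is_derive p v (X^~ i) (eval (X p) (delta i))) ->
  forall e, is_derive p v (fun q => eval (X q) e) (eval (X p) (deriv delta e)).
Proof.
move=> dX; elim=> [m n|i|e IHe|e IHe f IHf|e IHe f IHf] /=; rewrite ?evalE.
- by rewrite mul0r; exact: is_derive_cst.
- exact: dX.
- exact: is_deriveN.
- exact: is_deriveD.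
- by rewrite addrC [X in _ + X]mulrC; exact: is_deriveM.
Qed.

Lemma continuous_eval (T : topologicalType) (X : T -> I -> R) (p : T) :
  (forall i, {for p, continuous (X^~ i)}) ->
  forall e, {for p, continuous (fun q => eval (X q) e)}.
Proof.
move=> cX; elim=> [m n|i|e IHe|e IHe f IHf|e IHe f IHf] /=.
- exact: cvg_cst.
- exact: cX.
- exact: continuousN.
- exact: continuousD.
- exact: continuousM.
Qed.

End Eval.

(** * Smooth functions given by differential polynomials *)

Section Smooth.
Context {R : realType} {n : nat}.
Implicit Types (D : set 'rV[R]_n) (f g : 'rV[R]_n -> R).

Lemma eq_partial D f g i : open D -> (forall p, D p -> f p = g p) ->
  forall p, D p -> partial i f p = partial i g p.
Proof. by move=> oD fg p Dp; apply: near_eq_derive; exact: open_near fg. Qed.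

Lemma eq_foldr_partial D f g s : open D -> (forall p, D p -> f p = g p) ->
  forall p, D p -> foldr partial f s p = foldr partial g s p.
Proof. by move=> oD fg; elim: s => //= i s IHs; exact: eq_partial. Qed.

(** Derivatives are local: on an open set, equal functions have equal iterated partials near each
    point. *)
Lemma eq_smooth_on D f g : open D -> (forall p, D p -> f p = g p) ->
  smooth_on D g -> smooth_on D f.
Proof.
move=> oD fg sg s p Dp; have [cg dg] := sg s p Dp.
have E := open_near oD Dp (fun q Dq => esym (eq_foldr_partial s oD fg Dq)).
split; last by move=> i; exact: near_eq_derivable (dg i).
have Ep := eq_foldr_partial s oD fg Dp.
rewrite /prop_for /continuous_at Ep; apply: cvg_trans (near_eq_cvg E) _; exact: cg.
Qed.

Lemma smooth_cst D c : smooth_on D (fun=> c).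
Proof.
move=> s p _; have [c' ->] : exists c', foldr partial (fun=> c) s = fun=> c'.
  elim: s => [|i s [c' /= ->]]; first by exists c.
  by exists 0; apply/funext => q; exact: derive_cst.
by split; [apply: cst_continuous|move=> i; exact: derivable_cst].
Qed.

Lemma smooth_partial D f i : smooth_on D f -> smooth_on D (partial i f).
Proof. by move=> sf s p Dp; have := sf (rcons s i) p Dp; rewrite foldr_rcons. Qed.

Lemma smooth_iter_partial D f i k :
  smooth_on D f -> smooth_on D (iter k (partial i) f).
Proof.
move=> sf; elim: k => [|k IHk]; first exact: sf.
exact: smooth_partial IHk.
Qed.

Lemma smooth_continuous D f p : smooth_on D f -> D p -> {for p, continuous f}.
Proof. by move=> sf Dp; have [] := sf [::] p Dp. Qed.

Lemma smooth_is_derive D f p i : smooth_on D f -> D p ->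
  is_derive p (delta_mx 0 i) f (partial i f p).
Proof. by move=> sf Dp; have [_ /(_ i) /derivableP] := sf [::] p Dp. Qed.

Lemma partial_comm D f i j : open D -> smooth_on D f ->
  forall p, D p -> partial i (partial j f) p = partial j (partial i f) p.
Proof.
move=> oD sf p Dp; rewrite /partial.
have d1 k q : D q -> derivable f q (delta_mx 0 k).
  by move=> Dq; have [_] := sf [::] q Dq.
have d2 k l q : D q -> derivable (partial k f) q (delta_mx 0 l).
  by move=> Dq; have [_] := sf [:: k] q Dq.
have c2 k l : {for p, continuous (partial k (partial l f))}.
  by have [] := sf [:: k; l] p Dp.
by apply: (@derive_comm _ _ D) => //; [exact: d1|exact: d1|exact: d2|exact: d2
  |exact: c2|exact: c2].
Qed.

Lemma partial_iter_comm D f i j k : open D -> smooth_on D f ->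
  forall p, D p ->
    partial j (iter k (partial i) f) p = iter k (partial i) (partial j f) p.
Proof.
move=> oD sf; elim: k => //= k IHk p Dp.
rewrite (partial_comm j i oD (smooth_iter_partial i k sf) Dp).
exact: eq_partial IHk _ Dp.
Qed.

Context {I : Type} (X : 'rV[R]_n -> I -> R) (D : set 'rV[R]_n).

Lemma iter_partial_eval i delta f e : open D ->
  (forall a p, D p ->
    is_derive p (delta_mx 0 i) (X^~ a) (eval (X p) (delta a))) ->
  (forall p, D p -> f p = eval (X p) e) ->
  forall k p, D p ->
    iter k (partial i) f p = eval (X p) (iter k (deriv delta) e).
Proof.
move=> oD dX fe; elim=> [|k IHk] p Dp /=; first exact: fe.
rewrite (eq_partial i oD IHk Dp) /partial.
apply: derive_val.
apply: is_derive_eval => a; exact: dX.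
Qed.

Lemma partial_eval i delta f e : open D ->
  (forall a p, D p ->
    is_derive p (delta_mx 0 i) (X^~ a) (eval (X p) (delta a))) ->
  (forall p, D p -> f p = eval (X p) e) ->
  forall p, D p -> partial i f p = eval (X p) (deriv delta e).
Proof. by move=> oD dX fe; exact: (iter_partial_eval oD dX fe 1). Qed.

(** Every iterated partial of an evaluated expression is again an evaluated expression, hence
    continuous and derivable. *)
Lemma smooth_eval (delta : 'I_n -> I -> expr I) f e : open D ->
  (forall a p, D p -> {for p, continuous (X^~ a)}) ->
  (forall i a p, D p ->
    is_derive p (delta_mx 0 i) (X^~ a) (eval (X p) (delta i a))) ->
  (forall p, D p -> f p = eval (X p) e) -> smooth_on D f.
Proof.
move=> oD cX dX fe; apply: (@eq_smooth_on _ _ (fun p => eval (X p) e)) => //.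
have H s p : D p -> foldr partial (fun p => eval (X p) e) s p
    = eval (X p) (foldr (fun i => deriv (delta i)) e s).
  elim: s p => //= i s IHs p Dp.
  by rewrite (partial_eval oD (dX i) IHs Dp).
move=> s p Dp.
have E := open_near oD Dp (fun q Dq => esym (H s q Dq)).
split.
  rewrite /prop_for /continuous_at H//; apply: cvg_trans (near_eq_cvg E) _.
  exact: (continuous_eval (fun a => cX a p Dp)).
move=> i; apply: near_eq_derivable E _.
by apply: ex_derive; apply: is_derive_eval => a; exact: dX.
Qed.

(* Mixed partials commute, so differentiating an evolution equation
   [d_j f = rhs] along [i] gives the [j]-derivative of all [i]-derivatives. *)
Lemma prolongation i j delta f rhs : open D -> smooth_on D f ->
  (forall a p, D p ->
    is_derive p (delta_mx 0 i) (X^~ a) (eval (X p) (delta a))) ->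
  (forall p, D p -> partial j f p = eval (X p) rhs) ->
  forall k p, D p -> is_derive p (delta_mx 0 j) (iter k (partial i) f)
    (eval (X p) (iter k (deriv delta) rhs)).
Proof.
move=> oD sf dX fe k p Dp.
rewrite -(iter_partial_eval oD dX fe) // -(partial_iter_comm i j k oD sf Dp).
exact: smooth_is_derive (smooth_iter_partial _ _ sf) Dp.
Qed.

End Smooth.

(** * The Schwarzian KdV equation *)

(* [Some k] stands for the k-th derivative of F2 with respect to x and [None] for
   the inverse of the first one. *)
Definition schwarz_dx (a : option nat) : expr (option nat) :=
  (if a is Some k then Var (Some k.+1)
   else - (Var None * Var None * Var (Some 2%N)))%E.
Definition schwarz_rhs : expr (option nat) :=
  (Cst 3 2 * Var (Some 2%N) * Var (Some 2%N) * Var None - Var (Some 3%N))%E.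
(** For the inverse of F_x, the factor [deriv schwarz_dx schwarz_rhs] is the mixed derivative
    F_xz. *)
Definition schwarz_dz (a : option nat) : expr (option nat) :=
  (if a is Some k then iter k (deriv schwarz_dx) schwarz_rhs
   else - (Var None * Var None * deriv schwarz_dx schwarz_rhs))%E.
(** With v = F_xx / F_x this is the Miura transform v_x + v^2 / 2. *)
Definition schwarz_l : expr (option nat) :=
  ((Var (Some 3%N) - Cst 1 2 * Var (Some 2%N) * Var (Some 2%N) * Var None)
   * Var None)%E.

(** Only the closed expression is computed by [vm_compute]; the valuation and the real arithmetic
    remain opaque, so [field] receives a readable identity. *)
Ltac normalize_eval :=
  repeat match goal with
  | |- context [eval ?x ?e] =>
      let e' := eval vm_compute in e in progress change (eval x e) with (eval x e')
  end; cbn [eval].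

Lemma is_derive_inv (R : realType) (V : normedModType R) (f : V -> R) p v d :
  f p != 0 -> is_derive p v f d ->
  is_derive p v (fun q => (f q)^-1) (- ((f p)^-1 * (f p)^-1 * d)).
Proof.
move=> fp0 df; split; first exact: derivableV.
by rewrite deriveV // derive_val -exprVn expr2 [LHS]mulNr.
Qed.

Section SchwarzianKdV.
Context {R : realType}.
Variables (U : set 'rV[R]_2) (F l : 'rV[R]_2 -> R).
Hypotheses (openU : open U) (smoothF : smooth_on U F)
  (Fx_neq0 : forall q, U q -> partial 0 F q != 0)
  (F_eq : forall q, U q ->
     partial 1 F q + iter 3 (partial 0) F q
     - 3 / 2 * (iter 2 (partial 0) F q ^+ 2 / partial 0 F q) = 0)
  (l_def : forall q, U q ->
     l q = (iter 3 (partial 0) F q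
            - 1 / 2 * (iter 2 (partial 0) F q ^+ 2 / partial 0 F q))
           * (partial 0 F q)^-1).

Let X (q : 'rV[R]_2) (a : option nat) : R :=
  if a is Some k then iter k (partial 0) F q else (partial 0 F q)^-1.

Let Xc a q : U q -> {for q, continuous (X^~ a)}.
Proof.
move=> Uq; case: a => [k|].
  exact: smooth_continuous (smooth_iter_partial _ _ smoothF) Uq.
apply: (@continuousV _ _ (partial 0 F)); first exact: Fx_neq0.
exact: smooth_continuous (smooth_partial _ smoothF) Uq.
Qed.

Let X_dx a q : U q ->
  is_derive q (delta_mx 0 0) (X^~ a) (eval (X q) (schwarz_dx a)).
Proof.
move=> Uq; case: a => [k|].
  exact: smooth_is_derive (smooth_iter_partial _ _ smoothF) Uq.
rewrite !evalE; apply: is_derive_inv; first exact: Fx_neq0.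
exact: smooth_is_derive (smooth_partial _ smoothF) Uq.
Qed.

Let X_dz a q : U q ->
  is_derive q (delta_mx 0 1) (X^~ a) (eval (X q) (schwarz_dz a)).
Proof.
have F_z p : U p -> partial 1 F p = eval (X p) schwarz_rhs.
  move=> Up; have := F_eq Up; normalize_eval; rewrite /X.
  move: (iter 2 _ _ _) (iter 3 _ _ _) (partial 0 F p)^-1 (partial 1 F p).
  by move=> F2 F3 W Fz E; apply: subr0_eq; rewrite -E; field.
have H := prolongation openU smoothF X_dx F_z.
move=> Uq; case: a => [k|]; first exact: H.
rewrite eval_opp !eval_mul; apply: is_derive_inv; first exact: Fx_neq0.
(* F_x is the first iterate, so its z-derivative is the prolongation at k = 1. *)
exact: (H 1%N q Uq).
Qed.

Let X_d (i : 'I_2) a q : U q -> is_derive q (delta_mx 0 i) (X^~ a)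
  (eval (X q) ((if i == 0 then schwarz_dx else schwarz_dz) a)).
Proof.
case: i => [[|[|//]] i2].
  rewrite (_ : Ordinal i2 = 0); last exact: val_inj.
  exact: X_dx.
rewrite (_ : Ordinal i2 = 1); last exact: val_inj.
exact: X_dz.
Qed.

Let lE q : U q -> l q = eval (X q) schwarz_l.
Proof.
move=> Uq; rewrite l_def //; normalize_eval; rewrite /X.
move: (iter 2 _ _ _) (iter 3 _ _ _) (partial 0 F q)^-1 => F2 F3 W.
by field.
Qed.

Lemma smooth_miura : smooth_on U l.
Proof. exact: (smooth_eval openU Xc X_d lE). Qed.

Lemma kdv_miura q : U q ->
  partial 1 l q - 3 * l q * partial 0 l q + iter 3 (partial 0) l q = 0.
Proof.
move=> Uq.
rewrite (iter_partial_eval openU X_dx lE) // (partial_eval openU X_dx lE) //.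
rewrite (partial_eval openU X_dz lE) // lE //.
normalize_eval.
rewrite /X.
have := Fx_neq0 Uq.
(* F_x occurs both as an iterate and inside its inverse; a common form lets both become [F1],
   leaving a rational identity in independent quantities. *)
rewrite -[partial 0 F q]/(iter 1 (partial 0) F q).
move: (iter 1 _ _ _) (iter 2 _ _ _) (iter 3 _ _ _) (iter 4 _ _ _)
  (iter 5 _ _ _) (iter 6 _ _ _) => F1 F2 F3 F4 F5 F6 F1_neq0.
by field.
Qed.

End SchwarzianKdV.

(** * Curvature *)

Lemma eval_sum6 (R : realType) (x : var -> R) F :
  eval x (sum6 F) = \sum_(a < 6) eval x (F a).
Proof. by rewrite /sum6 !evalE !big_ord_recr big_ord0 /= add0r. Qed.

(** The metric of one block is constant along the other, so every term of a mixed component has a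
    factor that is syntactically 0; cancelling zeros suffices. *)
Lemma riemann_expr_mixed : all (fun i => all (fun j => all (fun k => all (fun l =>
  same_block [:: i; j; k; l] || is_zero (riemann_expr i j k l))
  (iota 0 6)) (iota 0 6)) (iota 0 6)) (iota 0 6).
Proof. by vm_compute. Qed.

(** All z-derivatives have been eliminated, so each component is a rational identity in [T] and
    x-jets treated as independent variables. *)
Lemma riemann_expr_block (R : realType) (x : var -> R) (b : bool) (i j k l : nat) :
  (forall b, x (VT b) != 0) -> (forall b, x (VW b) = (x (VT b))^-1) ->
  (i < 3)%N -> (j < 3)%N -> (k < 3)%N -> (l < 3)%N ->
  eval x (riemann_expr (3 * b + i) (3 * b + j) (3 * b + k) (3 * b + l)) = 0.
Proof.
move=> T0 W.
case: b; case: i => [|[|[|//]]] _; case: j => [|[|[|//]]] _;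
case: k => [|[|[|//]]] _; case: l => [|[|[|//]]] _; normalize_eval;
  rewrite ?W; by field; rewrite ?T0.
Qed.

Lemma riemann_expr_eq0 (R : realType) (x : var -> R) (i j k l : 'I_6) :
  (forall b, x (VT b) != 0) -> (forall b, x (VW b) = (x (VT b))^-1) ->
  eval x (riemann_expr i j k l) = 0.
Proof.
move=> T0 W.
have mem6 (a : 'I_6) : (a : nat) \in iota 0 6 by rewrite mem_iota ltn_ord.
have /allP/(_ _ (mem6 j))/allP/(_ _ (mem6 k))/allP/(_ _ (mem6 l)) :=
  allP riemann_expr_mixed _ (mem6 i).
case/orP => [|/is_zeroP //].
have split6 (a : 'I_6) : exists2 r, (r < 3)%N & nat_of_ord a = (3 * (3 <= a) + r)%N.
  by exists (if 3 <= a then a - 3 else a)%N; case: a => [[|[|[|[|[|[|//]]]]]] ?].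
rewrite /same_block /= !andbT => /and3P[/eqP hj /eqP hk /eqP hl].
have [ri ri3 ->] := split6 i; have [rj rj3 ->] := split6 j.
have [rk rk3 ->] := split6 k; have [rl rl3 ->] := split6 l.
rewrite hj hk hl; exact: riemann_expr_block.
Qed.

(** The difference quotients of [g \o c] along [v] are literally those of [g] along [c v];
    continuity of [c] does not enter. *)
Lemma is_derive_linear_comp (R : realType) (V V' : normedModType R)
    (c : V -> V') (g : V' -> R) p v d :
  (forall h : R, c (h *: v + p) = h *: c v + c p) ->
  is_derive (c p) (c v) g d -> is_derive p v (g \o c) d.
Proof.
move=> c_lin [g1 g2].
have E : (fun h : R => h^-1 *: (((g \o c) \o shift p) (h *: v) - (g \o c) p))
  = (fun h : R => h^-1 *: ((g \o shift (c p)) (h *: c v) - g (c p))).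
  by apply/funext => h; rewrite /= c_lin.
by split; [rewrite /derivable E|rewrite /derive E].
Qed.

Lemma coord2_continuous (R : realType) a c : continuous (@coord2 R a c).
Proof.
move=> p B /nbhs_ballP[e e0 eB]; apply/nbhs_ballP; exists e => // q pq.
apply: eB; case: pq => _ pq; split => // i j.
by rewrite !mxE; case: ifP => _; exact: pq.
Qed.

(** * Transfer of the symbolic computation to the actual metric *)

Section Flatness.
Context {R : realType}.
Variables (D : bool -> set 'rV[R]_2) (f : bool -> bool -> 'rV[R]_2 -> R).
Hypotheses (openD : forall b, open (D b))
  (smoothf : forall b c, smooth_on (D b) (f b c))
  (kdv : forall b q, D b q -> partial 1 (f b false) q
     - 3 * f b false q * partial 0 (f b false) q
     + iter 3 (partial 0) (f b false) q = 0)
  (miura : forall b q, D b q -> partial 1 (f b true) q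
     = f b false q * partial 0 (f b true) q + partial 0 (f b false) q
       + 2 * partial 0 (f b false) q * f b true q).

Let ia (b : bool) : 'I_6 := if b then iu else ix.
Let it (b : bool) : 'I_6 := if b then iv else iy.
Let ic (b : bool) : 'I_6 := if b then iw else iz.
Let proj b := @coord2 R (ia b) (ic b).

Let J b (q : 'rV[R]_2) (j : jet) : R := iter j.2 (partial 0) (f b j.1) q.
Let X (p : 'rV[R]_6) (v : var) : R :=
  match v with
  | VT b => p 0 (it b)
  | VW b => (p 0 (it b))^-1
  | VJ b j => J b (proj b p) j
  end.
Let dom : set 'rV[R]_6 := domain6 (D false) (D true).
Let g := metric6 (f false false) (f false true) (f true false) (f true true).

Let domP b p : dom p -> D b (proj b p) /\ p 0 (it b) != 0.
Proof. by case: b => -[]. Qed.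

Let J_dx b j q : D b q ->
  is_derive q (delta_mx 0 0) (J b ^~ j) (eval (J b q) (jet_dx j)).
Proof.
by move=> Dq; exact: smooth_is_derive (smooth_iter_partial _ _ (@smoothf b _)) Dq.
Qed.

Let J_dz b j q : D b q ->
  is_derive q (delta_mx 0 1) (J b ^~ j) (eval (J b q) (jet_dz j)).
Proof.
case: j => c k Dq.
have rhsE p : D b p -> partial 1 (f b c) p = eval (J b p) (jet_rhs c).
  move=> Dp; case: c; normalize_eval; rewrite /J.
    by rewrite miura//= ?divr1.
  have := kdv Dp.
  rewrite -[f b false p]/(iter 0 (partial 0) (f b false) p).
  rewrite -[partial 0 (f b false) p]/(iter 1 (partial 0) (f b false) p) /fst /snd.
  move: (iter 0 _ _ _) (iter 1 _ _ _) (iter 3 _ _ _) (partial 1 _ _) => L L1 L3 Lw E.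
  by apply: subr0_eq; rewrite -E; field.
exact: (prolongation (@openD b) (@smoothf b c) (@J_dx b) rhsE k Dq).
Qed.

Let proj_linear b (h : R) v p : proj b (h *: v + p) = h *: proj b v + proj b p.
Proof. by apply/rowP => k; rewrite !mxE; case: ifP. Qed.

(** For jets this is the chain rule: the projection of block [b] sends the i-th basis vector to the
    first or second basis vector of the plane, or to 0. *)
Let X_d (i : 'I_6) v p : dom p ->
  is_derive p (delta_mx 0 i) (X^~ v) (eval (X p) (var_d i v)).
Proof.
have dT b : is_derive p (delta_mx 0 i) (fun p => p 0 (it b)) (i == it b)%:R.
  apply: (@is_derive_linear_comp R 'rV[R]_6 R (fun p => p 0 (it b)) id p
    (delta_mx 0 i) (i == it b)%:R).
    by move=> h; rewrite !mxE.
  by rewrite mxE eqxx (eq_sym i); exact: is_derive_id.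
have itE b : (i == it b) = (i == 3 * b + 1 :> nat)%N by case: b.
move=> Dp; case: v => [b|b|b j].
- have := dT b; rewrite itE /=; case: ifP => _; rewrite /= ?divr1 ?mul0r.
    by [].
  by [].
- have [_ t0] := domP b Dp.
  have := is_derive_inv t0 (dT b); rewrite itE /=; case: ifP => _.
    by rewrite !evalE mulr1.
  by rewrite mulr0 oppr0 /= mul0r.
- have [Dq _] := domP b Dp.
  have comp d : is_derive (proj b p) (proj b (delta_mx 0 i)) (J b ^~ j) d ->
      is_derive p (delta_mx 0 i) (X^~ (VJ b j)) d.
    by apply: is_derive_linear_comp => h; exact: proj_linear.
  have XJ : X p \o VJ b = J b (proj b p) by [].
  rewrite /var_d; case: ifP => [/eqP ib|ib].
    rewrite eval_emap XJ; apply: comp.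
    rewrite (_ : proj b (delta_mx 0 i) = delta_mx 0 0); first exact: (@J_dx b j _ Dq).
    by apply/rowP => -[[|[|//]] ?]; rewrite !mxE /=;
      case: b {Dq XJ} ib; case: i {dT itE Dp} => [[|[|[|[|[|[|//]]]]]] ?].
  case: ifP => [/eqP ib'|ib'].
    rewrite eval_emap XJ; apply: comp.
    rewrite (_ : proj b (delta_mx 0 i) = delta_mx 0 1); first exact: (@J_dz b j _ Dq).
    by apply/rowP => -[[|[|//]] ?]; rewrite !mxE /=;
      case: b {Dq XJ ib} ib'; case: i {dT itE Dp} => [[|[|[|[|[|[|//]]]]]] ?].
  rewrite /= mul0r; apply: comp.
  rewrite (_ : proj b (delta_mx 0 i) = 0); first exact: is_derive0.
  apply/rowP => -[[|[|//]] ?]; rewrite !mxE /=; case: b {Dq XJ} ib ib';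
    by case: i {dT itE Dp} => [[|[|[|[|[|[|//]]]]]] ?].
Qed.

Let X_c v p : dom p -> {for p, continuous (X^~ v)}.
Proof.
move=> Dp; case: v => [b|b|b j].
- exact: coord_continuous.
- have [_ t0] := domP b Dp.
  by apply: continuousV => //; exact: coord_continuous.
- have [Dq _] := domP b Dp.
  apply: continuous_comp; first exact: coord2_continuous.
  exact: smooth_continuous (smooth_iter_partial _ _ (@smoothf b _)) Dq.
Qed.

Let open_dom : open dom.
Proof.
have oT b : open [set p : 'rV[R]_6 | p 0 (it b) != 0].
  apply: (@open_comp _ _ (fun p : 'rV[R]_6 => p 0 (it b)) [set x | x != 0]).
    by move=> p _; exact: coord_continuous.
  exact: open_neq.
have oJ b : open [set p : 'rV[R]_6 | D b (proj b p)].
  by apply: open_comp => // p _; exact: coord2_continuous.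
rewrite (_ : dom = [set p | D false (proj false p)] `&` [set p | D true (proj true p)]
  `&` [set p | p 0 (it false) != 0] `&` [set p | p 0 (it true) != 0]).
  exact: openI (openI (openI (oJ false) (oJ true)) (oT false)) (oT true).
by apply/seteqP; split => p [] // [[]].
Qed.

(** Valid at every point, even off the domain, because [block_metric] contains no [VW]. *)
Let metric_exprE i j p : g p i j = eval (X p) (metric_expr i j).
Proof.
rewrite /g /metric6 /line_element3 !mxE.
case: i => [[|[|[|[|[|[|//]]]]]] ?]; case: j => [[|[|[|[|[|[|//]]]]]] ?];
  normalize_eval; rewrite /X /J /=; by field.
Qed.

Let ginv p : 'M[R]_6 := \matrix_(i, j) eval (X p) (inverse_expr i j).

Let mul_ginv p : dom p -> g p *m ginv p = 1%:M.
Proof.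
move=> Dp; have T0 b : p 0 (it b) != 0 by have [] := domP b Dp.
apply/matrixP => i j; rewrite mxE.
transitivity (eval (X p) (sum6 (fun a => metric_expr i a * inverse_expr a j)%E)).
  by rewrite eval_sum6; apply: eq_bigr => a _; rewrite metric_exprE mxE eval_mul.
rewrite mxE.
case: i => [[|[|[|[|[|[|//]]]]]] ?]; case: j => [[|[|[|[|[|[|//]]]]]] ?];
  normalize_eval; move: (T0 false) (T0 true);
  rewrite /X /= => Ty Tv; by field; rewrite ?Ty ?Tv.
Qed.

Let g_unit p : dom p -> g p \in unitmx.
Proof. by move=> Dp; have [] := mulmx1_unit (mul_ginv Dp). Qed.

Let invmx_g p : dom p -> invmx (g p) = ginv p.
Proof.
by move=> Dp; rewrite -[RHS](mulKmx (g_unit Dp)) mul_ginv // mulmx1.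
Qed.

Let g_smooth i j : smooth_on dom (fun p => g p i j).
Proof.
apply: (smooth_eval (e := metric_expr i j) open_dom X_c X_d) => p _.
exact: metric_exprE.
Qed.

Let partial_dom (k : 'I_6) h e : (forall p, dom p -> h p = eval (X p) e) ->
  forall p, dom p -> partial k h p = eval (X p) (partial_expr k e).
Proof. exact: partial_eval open_dom (X_d k). Qed.

(** Holding on the whole open domain, this equality can be differentiated again to reach the
    curvature. *)
Let christoffelE (i j k : 'I_6) p : dom p ->
  christoffel g i j k p = eval (X p) (christoffel_expr i j k).
Proof.
move=> Dp; rewrite /christoffel /christoffel_expr eval_mul eval_sum6 /= div1r.
congr (_ * _); apply: eq_bigr => a _; rewrite !evalE invmx_g // mxE.
by rewrite !(partial_dom _ (fun q _ => metric_exprE _ _ q)).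
Qed.

Let riemann_up_eq0 (i j k l : 'I_6) p : dom p -> riemann_up g i j k l p = 0.
Proof.
move=> Dp; have T0 b : p 0 (it b) != 0 by have [] := domP b Dp.
have <- := @riemann_expr_eq0 R (X p) i j k l T0 (fun=> erefl).
rewrite /riemann_up /riemann_expr eval_add eval_sum6 eval_add eval_opp.
congr (_ - _ + _).
- exact: partial_dom (christoffelE i l j) _ Dp.
- exact: partial_dom (christoffelE i k j) _ Dp.
- by apply: eq_bigr => a _; rewrite eval_add eval_opp 2!eval_mul !christoffelE.
Qed.

Lemma metric6_flat : pseudo_riemannian_on dom g /\ flat_on dom g.
Proof.
split; last first.
  move=> p Dp i j k l; rewrite /riemann big1 // => a _.
  by rewrite riemann_up_eq0 // mulr0.
split; [exact: open_dom|exact: g_smooth| |exact: g_unit].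
move=> p _; apply/matrixP => i j; rewrite mxE !metric_exprE.
case: i => [[|[|[|[|[|[|//]]]]]] ?]; case: j => [[|[|[|[|[|[|//]]]]]] ?] //.
Qed.

End Flatness.

Theorem theorem3 (R : realType) (U V : set 'rV[R]_2)
  (F2 l m L M : 'rV[R]_2 -> R)
  (openU : open U) (openV : open V)
  (smoothF2 : smooth_on U F2)
  (F2x_neq0 : forall q, U q -> partial 0 F2 q != 0)
  (F2_eq : forall q, U q ->
     partial 1 F2 q + iter 3 (partial 0) F2 q
     - 3 / 2 * (iter 2 (partial 0) F2 q ^+ 2 / partial 0 F2 q) = 0)
  (l_def : forall q, U q ->
     l q = (iter 3 (partial 0) F2 q
            - 1 / 2 * (iter 2 (partial 0) F2 q ^+ 2 / partial 0 F2 q))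
           * (partial 0 F2 q)^-1)
  (m_def : forall q, U q -> m q = - (1 / 2))
  (smoothL : smooth_on V L) (smoothM : smooth_on V M)
  (L_eq : forall q, V q ->
     partial 1 L q - 3 * L q * partial 0 L q + iter 3 (partial 0) L q = 0)
  (M_eq : forall q, V q ->
     partial 1 M q
     = L q * partial 0 M q + partial 0 L q + 2 * partial 0 L q * M q) :
  pseudo_riemannian_on (domain6 U V) (metric6 l m L M) /\
  flat_on (domain6 U V) (metric6 l m L M).
Proof.
have dm q i : U q -> partial i m q = 0.
  by move=> Uq; rewrite (eq_partial i openU m_def Uq); exact: derive_cst.
apply: (@metric6_flat R (fun b => if b then V else U)
  (fun b c => if b then if c then M else L else if c then m else l)).
- by case.
- case=> -[].
  + exact: smoothM.
  + exact: smoothL.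
  + exact: (eq_smooth_on openU m_def (@smooth_cst R 2 U _)).
  + exact: smooth_miura openU smoothF2 F2x_neq0 F2_eq l_def.
- case=> q Dq; first exact: L_eq.
  exact: (kdv_miura openU smoothF2 F2x_neq0 F2_eq l_def).
- case=> q Dq; first exact: M_eq.
  (* The value -1/2 of [m] is what makes l_x + 2 l_x m vanish. *)
  by rewrite !dm // m_def //; field.
Qed.
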